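(* Let $\mathcal{X}$ and $\mathcal{Y}$ be sets, let $F:\mathcal{X}\to\mathcal{X}$, $G:\mathcal{X}\to\mathcal{Y}$ and $H:\mathcal{Y}\to\mathcal{Y}$ be functions, and let $X_0\in\mathcal{X}$. If $$G(F(X)) = H(G(X))\quad\text{for all } X\in\mathcal{X},$$ then the FG-program determined by $F,G,X_0$ is equivalent to the GH-program determined by $G,H,X_0$; that is, for every number $n\ge 0$ of loop iterations the two programs return the same answer: $G(F^n(X_0)) = H^n(G(X_0))$.
   Context: The FG-program is the iterative program: $X\leftarrow X_0$; repeat $X\leftarrow F(X)$ until some termination condition holds; then return $Y\leftarrow G(X)$. The GH-program is: $Y\leftarrow G(X_0)$; repeat $Y\leftarrow H(Y)$; return $Y$. No assumption is made about the termination condition of the FG-program; the GH-program is assumed to be executed for the same number of iterations as the FG-program, and ''equivalent'' means that the two programs then return the same final value $Y$. $F^n$ and $H^n$ denote $n$-fold iterates. *)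

(* Defs.v *)
From mathcomp Require Import all_boot.

Set Implicit Arguments.
Unset Strict Implicit.
Unset Printing Implicit Defensive.

Record iter_program (Y : Type) := IterProgram {
  state : Type;
  init : state;
  step : state -> state;
  output : state -> Y
}.

Arguments init {Y} _.
Arguments step {Y} _ _.
Arguments output {Y} _ _.

(* No termination condition is part of a program: what makes the loop stop is
   arbitrary, so the number n of iterations performed is a free parameter. *)
Definition answer (Y : Type) (P : iter_program Y) (n : nat) : Y :=
  output P (iter n (step P) (init P)).

Definition equivalent (Y : Type) (P Q : iter_program Y) : Prop :=
  forall n : nat, answer P n = answer Q n.

Definition FG_program (X Y : Type) (F : X -> X) (G : X -> Y) (X0 : X) :
    iter_program Y :=
  {| state := X; init := X0; step := F; output := G |}.

Definition GH_program (X Y : Type) (G : X -> Y) (H : Y -> Y) (X0 : X) :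
    iter_program Y :=
  {| state := Y; init := G X0; step := H; output := id |}.

(* Main.v *)
Require Import Defs.
From mathcomp Require Import all_boot.

(** [G] semiconjugates [F] to [H], and a semiconjugacy passes to all iterates by induction on
    [n]. *)

Theorem theorem3p1 (X Y : Type) (F : X -> X) (G : X -> Y) (H : Y -> Y) (X0 : X)
    (hGF : forall x : X, G (F x) = H (G x)) :
  equivalent (FG_program F G X0) (GH_program G H X0) /\
  (forall n : nat, G (iter n F X0) = iter n H (G X0)).
Proof.
have iterGF n : G (iter n F X0) = iter n H (G X0).
  (* [iter] puts the new step outermost, so [hGF] is applied at the current state [iter n F X0] and
     [X0] stays fixed in the induction. *)
  by elim: n => [|n IHn] //=; rewrite hGF IHn.
(* Both conjuncts are [iterGF] up to conversion: [answer] unfolds, and the output map of the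
   GH-program is [id]. *)
by split=> n; exact: iterGF.
Qed.
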